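(* Consider, for a partitioned optimization variable $(x,z)\in\mathbb R^{n_x}\times\mathbb R^{n_z}$, the problem $$\max\ f_0(x,z)\quad\text{s.t.}\quad x\le f_x(x,z),\quad z\le f_z(x,z), \qquad (R)$$ with data as in the context and $f=(f_x,f_z)$. Suppose that for all $(x,z)\in\mathcal D$: (a) $\nabla_xf_0(x,z)>0$ and $\nabla_zf_0(x,z)\ge0$; (b) $\nabla f(x,z)=\begin{bmatrix}\nabla_xf_x(x,z)&\nabla_xf_z(x,z)\\ \nabla_zf_x(x,z)&\nabla_zf_z(x,z)\end{bmatrix}\ge0$; (c) $\|\nabla f(x,z)\|<1$ for some matrix norm; and (d) $\nabla_zf_x(x,z)$ has non-zero rows. Then problem $(R)$ is Fast-Lipschitz.
   Context: Data: $n=n_x+n_z$; $f_0:\mathbb R^n\to\mathbb R^m$ ($m\ge1$), $f_x:\mathbb R^n\to\mathbb R^{n_x}$, $f_z:\mathbb R^n\to\mathbb R^{n_z}$ are differentiable. Notation: all inequalities between vectors or matrices are element-wise. Gradients are transposed Jacobians: $[\nabla h]_{ij}=\partial h_j/\partial(\text{$i$-th variable})$; $\nabla_xh$, $\nabla_zh$ denote the blocks of rows corresponding to derivatives in $x$ and in $z$. ''Non-zero rows'' means every row is non-zero. The (sub-multiplicative) matrix norm in (c) is the same for all $(x,z)\in\mathcal D$. Pareto optimality: maximization is with respect to the non-negative orthant of $\mathbb R^m$; a feasible point $\hat w$ is Pareto optimal if there is no other feasible $w$ with $f_0(w)\ge f_0(\hat w)$. Bounding box: $\mathcal D=\{w\in\mathbb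 R^n:a\le w\le b\}$. Standing assumptions: $f(\mathcal D)\subseteq\mathcal D$, and $\mathcal D$ contains all candidates for optimality, i.e., for every $\mu\in\mathbb R^m$ with $\mu>0$ the maximum of $\mu^Tf_0$ over the feasible set of $(R)$ is attained and every maximizer lies in $\mathcal D$. Fast-Lipschitz: $(R)$ is Fast-Lipschitz if it admits a unique Pareto optimal solution $(x^\star,z^\star)$, which is the unique solution (in $\mathcal D$) of $(x,z)=f(x,z)$. *)

(* Defs.v *)
From HB Require Import structures.
From mathcomp Require Import all_boot all_order all_algebra.
From mathcomp Require Import boolp classical_sets reals topology normedtype derive.

Set Implicit Arguments.
Unset Strict Implicit.
Unset Printing Implicit Defensive.

Import Order.TTheory GRing.Theory Num.Theory.
Import numFieldNormedType.Exports.

Local Open Scope classical_set_scope.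
Local Open Scope ring_scope.

(* Vectors are row vectors, as required by the library's Jacobian ['J].  The
   optimization variable w = (x, z) is a row of length nx + nz, with
   x = lsubmx w and z = rsubmx w. *)

Definition mxle (R : realType) p q (A B : 'M[R]_(p, q)) : Prop :=
  forall i j, A i j <= B i j.

Definition mxlt (R : realType) p q (A B : 'M[R]_(p, q)) : Prop :=
  forall i j, A i j < B i j.

Notation "A <=m B" := (mxle A B) (at level 70, no associativity).
Notation "A <m B" := (mxlt A B) (at level 70, no associativity).

(* ['J h w] acts on row vectors from the right ('d h w v = v *m 'J h w), so its
   (i, j) entry is the derivative of h_j in the i-th variable: it already is the
   transpose of the usual Jacobian and must not be transposed again. *)
Definition grad (R : realType) n p (h : 'rV[R]_n -> 'rV[R]_p) (w : 'rV[R]_n) :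
  'M[R]_(n, p) := 'J h w.

Lemma row_grad (R : realType) n p (h : 'rV[R]_n -> 'rV[R]_p) w i :
  differentiable h w -> row i (grad h w) = 'D_(delta_mx ord0 i) h w.
Proof. by move=> dh; rewrite deriveEjacobian // -rowE. Qed.

Definition gradx (R : realType) nx nz p (h : 'rV[R]_(nx + nz) -> 'rV[R]_p)
  (w : 'rV[R]_(nx + nz)) : 'M[R]_(nx, p) := usubmx (grad h w).

Definition gradz (R : realType) nx nz p (h : 'rV[R]_(nx + nz) -> 'rV[R]_p)
  (w : 'rV[R]_(nx + nz)) : 'M[R]_(nz, p) := dsubmx (grad h w).

Definition joint (R : realType) nx nz
  (fx : 'rV[R]_(nx + nz) -> 'rV[R]_nx) (fz : 'rV[R]_(nx + nz) -> 'rV[R]_nz)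
  (w : 'rV[R]_(nx + nz)) : 'rV[R]_(nx + nz) := row_mx (fx w) (fz w).

Lemma differentiable_joint (R : realType) nx nz
  (fx : 'rV[R]_(nx + nz) -> 'rV[R]_nx) (fz : 'rV[R]_(nx + nz) -> 'rV[R]_nz) w :
  differentiable fx w -> differentiable fz w -> differentiable (joint fx fz) w.
Proof.
move=> dfx dfz.
have dl v : differentiable (mulmxr (row_mx 1%:M 0) : 'rV[R]_nx -> 'rV[R]_(nx + nz)) v.
  apply: linear_differentiable => u A /nbhs_ballP[e /= e0 eA].
  apply/nbhs_ballP; exists e => //= v' [_ uv]; apply: eA; split => // i j.
  rewrite /= !mul_mx_row !mulmx0 !mulmx1 !mxE; case: split => k; first exact: uv.
  by rewrite !mxE; exact: ballxx.
have dr v : differentiable (mulmxr (row_mx 0 1%:M) : 'rV[R]_nz -> 'rV[R]_(nx + nz)) v.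
  apply: linear_differentiable => u A /nbhs_ballP[e /= e0 eA].
  apply/nbhs_ballP; exists e => //= v' [_ uv]; apply: eA; split => // i j.
  rewrite /= !mul_mx_row !mulmx0 !mulmx1 !mxE; case: split => k; last exact: uv.
  by rewrite !mxE; exact: ballxx.
pose L : 'rV[R]_nx -> 'rV[R]_(nx + nz) := mulmxr (row_mx 1%:M 0).
pose K : 'rV[R]_nz -> 'rV[R]_(nx + nz) := mulmxr (row_mx 0 1%:M).
have -> : joint fx fz = (fun v => L (fx v) + K (fz v)).
  apply/funext => v; rewrite /joint /L /K /=.
  by rewrite !mul_mx_row !mulmx0 !mulmx1 add_row_mx addr0 add0r.
apply: (@differentiableD _ _ _ (L \o fx) (K \o fz)).
  exact: differentiable_comp dfx (dl _).
exact: differentiable_comp dfz (dr _).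
Qed.

Lemma grad_joint (R : realType) nx nz
  (fx : 'rV[R]_(nx + nz) -> 'rV[R]_nx) (fz : 'rV[R]_(nx + nz) -> 'rV[R]_nz) w :
  differentiable fx w -> differentiable fz w ->
  grad (joint fx fz) w =
  block_mx (gradx fx w) (gradx fz w) (gradz fx w) (gradz fz w).
Proof.
move=> dfx dfz; have df := differentiable_joint dfx dfz.
rewrite block_mxEh /gradx /gradz !vsubmxK.
have El : lsubmx \o joint fx fz = fx by apply/funext => v; rewrite /= row_mxKl.
have Er : rsubmx \o joint fx fz = fz by apply/funext => v; rewrite /= row_mxKr.
have Kl v : 'd fx w v = lsubmx ('d (joint fx fz) w v).
  rewrite -[in LHS]El diff_comp //; last exact: differentiable_lsubmx.
  by rewrite /= diff_lin //; exact: continuous_lsubmx.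
have Kr v : 'd fz w v = rsubmx ('d (joint fx fz) w v).
  rewrite -[in LHS]Er diff_comp //; last exact: differentiable_rsubmx.
  by rewrite /= diff_lin //; exact: continuous_rsubmx.
apply/matrixP => i j; rewrite /grad /jacobian !mxE.
by case: (split_ordP j) => k ->; rewrite mxE ?Kl ?Kr mxE.
Qed.

Definition submultiplicative_norm (R : realType) n (N : 'M[R]_n -> R) : Prop :=
  [/\ forall A, 0 <= N A,
      forall A, N A = 0 -> A = 0,
      forall c A, N (c *: A) = `|c| * N A,
      forall A B, N (A + B) <= N A + N B
    & forall A B, N (A *m B) <= N A * N B].

Definition box (R : realType) n (a b : 'rV[R]_n) : set 'rV[R]_n :=
  [set w | a <=m w /\ w <=m b].

Definition feasible (R : realType) nx nz
  (fx : 'rV[R]_(nx + nz) -> 'rV[R]_nx) (fz : 'rV[R]_(nx + nz) -> 'rV[R]_nz) :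
  set 'rV[R]_(nx + nz) :=
  [set w | lsubmx w <=m fx w /\ rsubmx w <=m fz w].

(* No other feasible point is at least as good: a distinct feasible point with the
   same objective value already excludes optimality. *)
Definition pareto_optimal (R : realType) n m (f0 : 'rV[R]_n -> 'rV[R]_m)
  (S : set 'rV[R]_n) (w' : 'rV[R]_n) : Prop :=
  S w' /\ ~ (exists w, [/\ S w, w <> w' & f0 w' <=m f0 w]).

Definition maximizer (R : realType) n (g : 'rV[R]_n -> R) (S : set 'rV[R]_n)
  (w' : 'rV[R]_n) : Prop :=
  S w' /\ forall w, S w -> g w <= g w'.

Definition scalarized (R : realType) n m (f0 : 'rV[R]_n -> 'rV[R]_m)
  (mu : 'rV[R]_m) (w : 'rV[R]_n) : R := \sum_(k < m) mu ord0 k * f0 w ord0 k.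

Definition contains_candidates (R : realType) n m
  (f0 : 'rV[R]_n -> 'rV[R]_m) (S D : set 'rV[R]_n) : Prop :=
  forall mu : 'rV[R]_m, 0 <m mu ->
    (exists w, maximizer (scalarized f0 mu) S w) /\
    (forall w, maximizer (scalarized f0 mu) S w -> D w).

Definition fast_lipschitz (R : realType) nx nz m
  (f0 : 'rV[R]_(nx + nz) -> 'rV[R]_m)
  (fx : 'rV[R]_(nx + nz) -> 'rV[R]_nx) (fz : 'rV[R]_(nx + nz) -> 'rV[R]_nz)
  (D : set 'rV[R]_(nx + nz)) : Prop :=
  exists ws, unique (pareto_optimal f0 (feasible fx fz)) ws /\
             unique (fun w => D w /\ w = joint fx fz w) ws.

(* Main.v *)
Require Import Defs.
From mathcomp Require Import all_boot all_order all_algebra.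
From mathcomp Require Import boolp classical_sets functions reals topology normedtype derive.
From mathcomp Require Import lra.

Set Implicit Arguments.
Unset Strict Implicit.
Unset Printing Implicit Defensive.

Import Order.TTheory GRing.Theory Num.Theory.
Import numFieldNormedType.Exports.

Local Open Scope classical_set_scope.
Local Open Scope ring_scope.

(** The proof rests on the scalarized problems, max [mu^T f0] over the feasible
set [S] with [mu > 0], whose maximizers exist and lie in the box [D].

A feasible [w] in [D] satisfies [w <= f w]. Since [f] is monotone on [D] and
maps [D] to itself, [f w] and [f (f w)] are again feasible points of [D], with
[w <= f w <= f (f w)]. If [w] maximizes [mu^T f0], the objective, which is
monotone on [D], must be constant along this chain. As it grows strictly with
[x], the three points share their [x] part; in particular [fx w = fx (f w)]. But
[fx] grows strictly, in at least one component, when any coordinate of [z] grows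
(non-zero rows), so [w] and [f w] also share their [z] part: every maximizer is
a fixed point of [f] ([maximizer_fixpoint]). The non-zero rows thus make up for
an objective that may be indifferent to [z].

The fixed point in [D] is unique because [f] shortens segments strictly in the
row norm induced by the matrix norm ([fixpoint_unique]). The gradient norm is
only pointwise below 1 and the gradient need not be continuous, so there is no
uniform contraction factor, and the existence of the fixed point is not drawn
from a contraction argument but from the existence of a maximizer.

Hence one point [ws] maximizes [mu^T f0] over [S] for every [mu > 0], which means
that [f0 w <= f0 ws] for every feasible [w], inside or outside [D]
([mxle_of_scalarized]). So a Pareto optimal point other than [ws] would be
dominated by [ws]. Conversely a feasible [w] with [f0 ws <= f0 w] is itself a
maximizer, hence a fixed point in [D], hence [ws]. *)

(** * Differentiation along segments *)

Section SegmentCalculus.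
Variables (R : realType) (n p : nat) (h : 'rV[R]_n -> 'rV[R]_p).
Hypothesis dh : forall w, differentiable h w.

Lemma is_derive_line (u d : 'rV[R]_n) (t : R) :
  is_derive t 1 (fun s : R => h (u + s *: d)) (d *m grad h (u + t *: d)).
Proof.
(* Both derivatives are limits of the same difference quotient. *)
have E : (fun s : R => s^-1 *: (h (u + (s *: 1 + t) *: d) - h (u + t *: d))) =
         (fun s : R => s^-1 *: (h (s *: d + (u + t *: d)) - h (u + t *: d))).
  apply/funext => s; congr (_ *: (h _ - _)).
  by rewrite [s *: 1]mulr1 scalerDl addrCA.
have /derivable_mxP dd : derivable h (u + t *: d) d by exact: diff_derivable.
split.
  rewrite /derivable /= E; exact: diff_derivable.
by rewrite /grad -deriveEjacobian // /derive /= E.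
Qed.

Lemma is_derive_line_coord (u d : 'rV[R]_n) (k : 'I_p) (t : R) :
  is_derive t 1 (fun s : R => h (u + s *: d) ord0 k)
    ((d *m grad h (u + t *: d)) ord0 k).
Proof.
have D := is_derive_line u d t.
have dD : derivable (fun s : R => h (u + s *: d)) t 1 by [].
split; first exact: (derivable_mxP _ _ _).1.
have := @derive_val _ _ _ _ _ _ _ D.
by rewrite derive_mx // => <-; rewrite mxE.
Qed.

(** The mean value theorem fails for vector-valued maps, but holds for each linear
combination of the components. *)
Lemma scalarized_MVT (c : 'rV[R]_p) (u v : 'rV[R]_n) :
  exists2 t : R, t \in `]0, 1[ &
    scalarized h c v - scalarized h c u =
    \sum_(k < p) c ord0 k * ((v - u) *m grad h (u + t *: (v - u))) ord0 k.
Proof.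
set d := v - u.
pose phi := fun t : R => scalarized h c (u + t *: d).
pose dphi t := \sum_(k < p) c ord0 k * (d *m grad h (u + t *: d)) ord0 k.
have D (t : R) : is_derive t (1 : R) phi (dphi t).
  have -> : phi = \sum_(k < p)
      ((c ord0 k \*: (fun s : R => h (u + s *: d) ord0 k)) : R -> R).
    by apply/funext => s; rewrite fct_sumE.
  apply: is_derive_sum => k; apply: is_deriveZ; exact: is_derive_line_coord.
have [|t t01] := @MVT R phi dphi 0 1 ltr01 (fun t _ => D t).
  apply: derivable_within_continuous => t _; exact: ex_derive.
have ud : u + d = v by rewrite addrC subrK.
by rewrite subr0 mulr1 /phi scale1r scale0r addr0 ud => E; exists t.
Qed.

End SegmentCalculus.

(** * The row norm induced by a matrix norm *)

Section RowNorm.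
Variables (R : realType) (n : nat) (N : 'M[R]_n -> R).
Hypothesis HN : submultiplicative_norm N.

(** Stacking copies of a row turns its product with [A] into a product of square
matrices, so submultiplicativity makes this norm compatible with [N]. *)
Definition row_norm (v : 'rV[R]_n) : R := N (\matrix_(i < n) v).

Lemma row_normM v A : row_norm (v *m A) <= row_norm v * N A.
Proof.
case: HN => _ _ _ _ /(_ (\matrix_i v) A).
suff -> : (\matrix_(i < n) v) *m A = \matrix_i (v *m A) by [].
by apply/row_matrixP => i; rewrite row_mul !rowK.
Qed.

Lemma row_normZ c v : row_norm (c *: v) = `|c| * row_norm v.
Proof.
case: HN => _ _ H _ _; rewrite /row_norm -H.
by congr (N _); apply/matrixP => i j; rewrite !mxE.
Qed.

Lemma row_norm0 : row_norm 0 = 0.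
Proof. by rewrite -(scale0r (0 : 'rV[R]_n)) row_normZ normr0 mul0r. Qed.

Lemma row_normD u v : row_norm (u + v) <= row_norm u + row_norm v.
Proof.
case: HN => _ _ _ /(_ (\matrix_i u) (\matrix_i v)) + _.
suff -> : \matrix_(i < n) u + \matrix_i v = \matrix_i (u + v) by [].
by apply/matrixP => i j; rewrite !mxE.
Qed.

Lemma row_norm_ge0 v : 0 <= row_norm v.
Proof. by case: HN => H _ _ _ _; exact: H. Qed.

Lemma row_norm_eq0 v : row_norm v = 0 -> v = 0.
Proof.
case: HN => _ H _ _ _ /H E; apply/rowP => i.
by move/matrixP/(_ i i): E; rewrite !mxE.
Qed.

Lemma row_norm_bound :
  exists2 C, 0 < C & forall v, row_norm v <= C * `|v|.
Proof.
exists (1 + \sum_(j < n) row_norm (delta_mx ord0 j)).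
  by rewrite ltr_wpDr // sumr_ge0 // => j _; exact: row_norm_ge0.
move=> v; rewrite mulrDl mul1r ler_wpDl // {1}(row_sum_delta v) mulr_suml.
elim/big_ind2: _ => [|x1 x2 y1 y2 H1 H2|j _].
- by rewrite row_norm0.
- exact: le_trans (row_normD _ _) (lerD H1 H2).
- rewrite row_normZ mulrC ler_wpM2l ?row_norm_ge0 //.
  rewrite [leRHS]/Num.norm /= mx_normrE.
  by apply/bigmax_geP; right; exists (ord0, j).
Qed.
Lemma row_norm_continuous : continuous row_norm.
Proof.
have [C C0 HC] := row_norm_bound => w.
have sub u v : row_norm u - row_norm v <= C * `|u - v|.
  rewrite lerBlDr; apply: le_trans (lerD (HC _) (lexx _)).
  by rewrite -{1}(subrK v u) row_normD.
apply/(@cvgrPdist_le _ _ _ _ (nbhs_filter w)) => e e0.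
apply/nbhs_ballP; exists (e / C) => [|v]; first exact: divr_gt0.
rewrite mx_norm_ball /ball_ /= ltr_pdivlMr // mulrC => /ltW wv.
rewrite ler_norml lerNl opprB; apply/andP; split.
  by apply: le_trans (sub _ _) _; rewrite distrC.
exact: le_trans (sub _ _) wv.
Qed.

End RowNorm.

(** * Uniqueness of the fixed point *)

Lemma box_segment (R : realType) n (a b u v : 'rV[R]_n) (t : R) :
  box a b u -> box a b v -> 0 <= t <= 1 -> box a b (u + t *: (v - u)).
Proof.
move=> [au ub] [av vb] /andP[t0 t1].
by split=> i j; have := au i j; have := ub i j; have := av i j;
  have := vb i j; rewrite !mxE; nra.
Qed.

(** Two distinct fixed points [u] and [v] would give a curve [g t = f (u + t d)],
with [d = v - u], whose endpoints are [P d] apart ([P] the row norm), although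
its speed [P (d *m grad f _)] is everywhere below [P d]. The strict inequality
has to be recovered without a bound uniform in [t]: at a minimum [s < 1] of
[phi t = P (g t - g 0) - t P d] the difference quotients of [g] to the right of
[s] have norm at least [P d], hence so has the derivative at [s]. *)
Lemma fixpoint_unique (R : realType) n (f : 'rV[R]_n -> 'rV[R]_n)
  (N : 'M[R]_n -> R) (a b u v : 'rV[R]_n) :
  (forall w, differentiable f w) -> submultiplicative_norm N ->
  (forall w, box a b w -> N (grad f w) < 1) ->
  box a b u -> box a b v -> u = f u -> v = f v -> u = v.
Proof.
move=> df HN Nlt1 au av fu fv; apply/eqP/negPn/negP => uv.
set d := v - u.
have dn0 : d != 0 by rewrite subr_eq0 eq_sym.
pose P := row_norm N.
have P0 : 0 < P d.
  rewrite lt_neqAle row_norm_ge0 // andbT eq_sym.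
  by apply: contra_neq dn0; exact: row_norm_eq0.
pose g (t : R) := f (u + t *: d).
pose phi (t : R) : R := P (g t - g 0) - t * P d.
have g0 : g 0 = u by rewrite /g scale0r addr0 -fu.
have g1 : g 1 = v by rewrite /g scale1r addrC subrK -fv.
have cg : continuous g.
  move=> t; apply: differentiable_continuous; apply/derivable1_diffP.
  exact: (@ex_derive _ _ _ _ _ _ _ (is_derive_line df u d t)).
have cphi : continuous phi.
  move=> t; apply: cvgB; last by apply: cvgM; [exact: cvg_id | exact: cvg_cst].
  apply: (continuous_comp (f := fun s => g s - g 0)); last exact: row_norm_continuous.
  by apply: cvgB; [exact: cg | exact: cvg_cst].
(* [phi 0 = phi 1 = 0], so a minimum at the right end is also attained at 0. *)
have [s s01 mins] : exists2 s : R, 0 <= s < 1 &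
    forall t, 0 <= t <= 1 -> phi s <= phi t.
  have [c + minc] := EVT_min ler01 (continuous_subspaceT cphi).
  rewrite in_itv /= => /andP[c0 c1].
  have {}minc t : 0 <= t <= 1 -> phi c <= phi t.
    by move=> t01; apply: minc; rewrite in_itv.
  case: (ltP c 1) => c1'; first by exists c; rewrite ?c0.
  exists 0; first by rewrite lexx ltr01.
  move=> t /minc; apply: le_trans.
  have -> : c = 1 by apply/eqP; rewrite eq_le c1.
  by rewrite /phi g0 g1 -/d subrr mul0r mul1r subr0 subrr /P row_norm0.
have {s01} [s0 s1] := andP s01.
have bs : box a b (u + s *: d) by apply: box_segment; rewrite ?s0 ?ltW.
have [/= derg valg] := is_derive_line df u d s.
suff : P d <= P (d *m grad f (u + s *: d)).
  apply/negP; rewrite -ltNge; apply: le_lt_trans (row_normM HN _ _) _.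
  by rewrite gtr_pMr // Nlt1.
have cv : (fun k : R => k^-1 *: (g (k + s) - g s)) @ 0^'+ -->
    d *m grad f (u + s *: d).
  rewrite -valg.
  have -> : (fun k : R => k^-1 *: (g (k + s) - g s)) =
      (fun k => k^-1 *: ((g \o shift s) (k *: (1 : R)) - g s)).
    by apply/funext => k; rewrite /= [k *: 1]mulr1.
  apply: cvg_trans derg; apply: cvg_app.
  apply: within_subset => k /=; exact: lt0r_neq0.
apply: (cvgr_to_ge (cvg_comp _ _ cv (@row_norm_continuous _ _ _ HN _))).
near=> k.
have k0 : 0 < k by near: k; exact: nbhs_right_gt.
have ks : k + s <= 1.
  by rewrite -lerBrDr; near: k; apply: nbhs_right_le; rewrite subr_gt0.
have k01 : 0 <= k + s <= 1 by rewrite ks andbT addr_ge0 // ltW.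
rewrite -[X in _ <= X]/(P (k^-1 *: (g (k + s) - g s))) /P row_normZ // -/P.
rewrite gtr0_norm ?invr_gt0 // ler_pdivlMl //.
have := row_normD HN (g (k + s) - g s) (g s - g 0).
have := mins _ k01.
by rewrite subrKA -/P /phi; lra.
Unshelve. all: by end_near.
Qed.

(** * Monotonicity from non-negative gradients *)

Section Monotone.
Variables (R : realType) (n p : nat) (h : 'rV[R]_n -> 'rV[R]_p).
Variables (a b u v : 'rV[R]_n).
Hypotheses (dh : forall w, differentiable h w)
  (grad_ge0 : forall w, box a b w -> 0 <=m grad h w)
  (bu : box a b u) (bv : box a b v) (uv : u <=m v).

(** By the mean value theorem the increment is a sum of non-negative terms, one for
each variable and component, so without an increase they all vanish at the
intermediate point. Strict monotonicity statements follow by exhibiting a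
non-zero entry of the gradient there. *)
Lemma scalarized_incr (c : 'rV[R]_p) : 0 <=m c ->
  scalarized h c u <= scalarized h c v /\
  (scalarized h c v <= scalarized h c u -> exists2 w, box a b w &
     forall i k, c ord0 k * ((v ord0 i - u ord0 i) * grad h w i k) = 0).
Proof.
move=> c0; have [t] := scalarized_MVT dh c u v.
rewrite in_itv /= => /andP[t0 t1].
set w := u + _; have bw : box a b w by apply: box_segment; rewrite ?ltW.
have -> : \sum_(k < p) c ord0 k * ((v - u) *m grad h w) ord0 k =
    \sum_(k < p) \sum_(i < n)
      c ord0 k * ((v ord0 i - u ord0 i) * grad h w i k).
  apply: eq_bigr => k _; rewrite mxE mulr_sumr.
  by apply: eq_bigr => i _; rewrite !mxE.
have term_ge0 k i : 0 <= c ord0 k * ((v ord0 i - u ord0 i) * grad h w i k).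
  have := c0 ord0 k; have := grad_ge0 bw i k; rewrite !mxE => g0 ck0.
  by rewrite !mulr_ge0 // subr_ge0.
move=> E; split.
  by rewrite -subr_ge0 E; do 2!(apply: sumr_ge0 => ? _).
rewrite -subr_le0 E => le0; exists w => // i k.
have /psumr_eq0P sum0 : \sum_(k < p) \sum_(i < n)
    c ord0 k * ((v ord0 i - u ord0 i) * grad h w i k) = 0.
  by apply/eqP; rewrite eq_le le0; do 2!(apply: sumr_ge0 => ? _).
have /psumr_eq0P := sum0 (fun k _ => sumr_ge0 _ (fun i _ => term_ge0 k i)) k isT.
by apply.
Qed.

Lemma grad_ge0_mono : h u <=m h v.
Proof.
have coord (w : 'rV[R]_n) k : scalarized h (delta_mx ord0 k) w = h w ord0 k.
  rewrite /scalarized (bigD1 k) //= big1 => [|l lk].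
    by rewrite mxE !eqxx mul1r addr0.
  by rewrite mxE (negPf lk) andbF mul0r.
move=> i k; rewrite (ord1 i) -!coord.
by apply: (scalarized_incr _).1 => j l; rewrite !mxE ler0n.
Qed.

End Monotone.

(** * Maximizers of scalarizations *)

(** If component [k] violated the order, a weight on it large enough to outweigh
all the other components would violate the scalarized inequality. *)
Lemma mxle_of_scalarized (R : realType) n m (f0 : 'rV[R]_n -> 'rV[R]_m) u v :
  (forall mu, 0 <m mu -> scalarized f0 mu u <= scalarized f0 mu v) ->
  f0 u <=m f0 v.
Proof.
move=> le_mu i k; rewrite (ord1 i) {i} leNgt; apply/negP => lt_k.
pose d l := f0 u ord0 l - f0 v ord0 l.
have dk : 0 < d k by rewrite subr_gt0.
pose s := \sum_(l < m | l != k) `|d l|.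
have s0 : 0 <= s by exact: sumr_ge0.
(* Component k contributes s + 1, the others together at least - s. *)
pose mu : 'rV[R]_m := \row_l (if l == k then (s + 1) / d k else 1).
have mu0 : 0 <m mu.
  by move=> i l; rewrite !mxE; case: ifP => // _; rewrite divr_gt0 // ltr_wpDl.
have := le_mu _ mu0; rewrite -subr_le0 /scalarized -sumrB.
rewrite (bigD1 k) //= -mulrBr mxE eqxx divfK ?gt_eqF //.
have : - s <= \sum_(l < m | l != k)
    (mu ord0 l * f0 u ord0 l - mu ord0 l * f0 v ord0 l).
  rewrite -sumrN; apply: ler_sum => l /negPf lk.
  by rewrite mxE lk !mul1r lerNl -normrN ler_norm.
lra.
Qed.

Section FastLipschitz.
Variables (R : realType) (nx nz m : nat).
Variables (f0 : 'rV[R]_(nx + nz) -> 'rV[R]_m)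
  (fx : 'rV[R]_(nx + nz) -> 'rV[R]_nx) (fz : 'rV[R]_(nx + nz) -> 'rV[R]_nz).
Variables (a b : 'rV[R]_(nx + nz)).
Hypotheses (hm : (0 < m)%N) (df0 : forall w, differentiable f0 w)
  (dfx : forall w, differentiable fx w) (dfz : forall w, differentiable fz w).
Let f := joint fx fz.
Let S := feasible fx fz.
Let D := box a b.
Hypotheses (f_box : f @` D `<=` D)
  (grad_f0 : forall w, D w -> 0 <m gradx f0 w /\ 0 <=m gradz f0 w)
  (grad_f : forall w, D w -> 0 <=m grad f w)
  (rows_f : forall w, D w -> forall j, row j (gradz fx w) != 0).

Lemma feasibleE w : S w <-> w <=m f w.
Proof.
split=> [[wx wz] i j|wf].
  rewrite (ord1 i) /f /joint mxE; case: (split_ordP j) => k -> /=.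
    by have := wx ord0 k; rewrite mxE.
  by have := wz ord0 k; rewrite mxE.
split=> i j.
  by have := wf i (lshift nz j); rewrite (ord1 i) /f /joint row_mxEl mxE.
by have := wf i (rshift nx j); rewrite (ord1 i) /f /joint row_mxEr mxE.
Qed.

Lemma f_mono u v : D u -> D v -> u <=m v -> f u <=m f v.
Proof.
move=> Du Dv; apply: grad_ge0_mono grad_f Du Dv => w.
exact: differentiable_joint.
Qed.

Lemma feasible_f w : D w -> S w -> S (f w).
Proof.
move=> Dw /feasibleE wf; apply/feasibleE; apply: f_mono => //.
by apply: f_box; exists w.
Qed.

(** Strictness in [x] alone needs a single component of [f0] with a positive gradient
in [x]: this is where [0 < m] enters. *)
Lemma objective_mono (mu : 'rV[R]_m) u v :
  0 <m mu -> D u -> D v -> u <=m v ->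
  scalarized f0 mu u <= scalarized f0 mu v /\
  (scalarized f0 mu v <= scalarized f0 mu u -> lsubmx u = lsubmx v).
Proof.
move=> mu0 Du Dv uv.
have grad0 w : D w -> 0 <=m grad f0 w.
  move=> /grad_f0[gx gz] i k; rewrite mxE; case: (split_ordP i) => j ->.
    by have := gx j k; rewrite !mxE => /ltW.
  by have := gz j k; rewrite !mxE.
have [|le_uv strict] := scalarized_incr df0 grad0 Du Dv uv (c := mu).
  by move=> i j; exact: ltW.
split=> // /strict[w Dw eq0]; apply/rowP => j; rewrite !mxE.
pose k := Ordinal hm; have gx : 0 < grad f0 w (lshift nz j) k.
  by have [/(_ j k)] := grad_f0 Dw; rewrite !mxE.
have muk : 0 < mu ord0 k by have := mu0 ord0 k; rewrite mxE.
have /eqP := eq0 (lshift nz j) k.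
by rewrite !mulf_eq0 (gt_eqF muk) (gt_eqF gx) orbF subr_eq0 => /eqP.
Qed.

(** Every coordinate of [z] has, at the intermediate point given by the mean value
theorem, a positive influence on some component of [fx]. *)
Lemma fx_strict u v :
  D u -> D v -> u <=m v -> fx u = fx v -> rsubmx u = rsubmx v.
Proof.
move=> Du Dv uv fuv.
have gradx0 w : D w -> 0 <=m grad fx w.
  move=> /grad_f; rewrite /f grad_joint // block_mxEh !vsubmxK => G i k.
  by have := G i (lshift nz k); rewrite row_mxEl !mxE.
have [|_] := scalarized_incr dfx gradx0 Du Dv uv (c := const_mx 1).
  by move=> i j; rewrite !mxE.
rewrite /scalarized fuv => /(_ (lexx _))[w Dw eq0].
apply/rowP => j; rewrite !mxE.
have [k gk] : exists k, grad fx w (rshift nx j) k != 0.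
  by have /rV0Pn[k gk] := rows_f Dw j; exists k; move: gk; rewrite !mxE.
have /eqP := eq0 (rshift nx j) k.
by rewrite mxE mul1r mulf_eq0 (negPf gk) orbF subr_eq0 => /eqP.
Qed.

(** Two steps of [f] are needed: that [w] and [f w] have equal objectives equates
their [x] parts only; the next step compares [fx w] with [fx (f w)], which
detects a difference in [z]. *)
Lemma maximizer_fixpoint (mu : 'rV[R]_m) w : 0 <m mu ->
  D w -> maximizer (scalarized f0 mu) S w -> w = f w.
Proof.
move=> mu0 Dw [Sw maxw].
have Df u : D u -> D (f u) by move=> Du; apply: f_box; exists u.
have wf : w <=m f w by exact/feasibleE.
have fff : f w <=m f (f w) by apply: f_mono => //; exact: Df.
have Sff : S (f (f w)) by apply: feasible_f; [exact: Df | exact: feasible_f].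
have [le1 strict1] := objective_mono mu0 Dw (Df _ Dw) wf.
have [le2 strict2] := objective_mono mu0 (Df _ Dw) (Df _ (Df _ Dw)) fff.
have x1 := strict1 (maxw _ (feasible_f Dw Sw)).
have x2 := strict2 (le_trans (maxw _ Sff) le1).
have z1 : rsubmx w = rsubmx (f w).
  apply: fx_strict => //; first exact: Df.
  by move: x2; rewrite /f /joint !row_mxKl.
by rewrite -[LHS]hsubmxK x1 z1 hsubmxK.
Qed.

End FastLipschitz.

Theorem proposition21 (R : realType) (nx nz m : nat) (hm : (0 < m)%N)
  (f0 : 'rV[R]_(nx + nz) -> 'rV[R]_m)
  (fx : 'rV[R]_(nx + nz) -> 'rV[R]_nx)
  (fz : 'rV[R]_(nx + nz) -> 'rV[R]_nz)
  (df0 : forall w, differentiable f0 w)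
  (dfx : forall w, differentiable fx w)
  (dfz : forall w, differentiable fz w)
  (a b : 'rV[R]_(nx + nz))
  (f_box : joint fx fz @` box a b `<=` box a b)
  (box_candidates : contains_candidates f0 (feasible fx fz) (box a b))
  (cond_a : forall w, box a b w -> 0 <m gradx f0 w /\ 0 <=m gradz f0 w)
  (cond_b : forall w, box a b w -> 0 <=m grad (joint fx fz) w)
  (cond_c : exists N : 'M[R]_(nx + nz) -> R, submultiplicative_norm N /\
    forall w, box a b w -> N (grad (joint fx fz) w) < 1)
  (cond_d : forall w, box a b w -> forall j, row j (gradz fx w) != 0) :
  fast_lipschitz f0 fx fz (box a b).
Proof.
have [N [HN Nlt1]] := cond_c.
set S := feasible fx fz; set D := box a b.
have fixE u v : D u -> D v -> u = joint fx fz u -> v = joint fx fz v -> u = v.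
  by apply: fixpoint_unique HN Nlt1 => w; exact: differentiable_joint.
have fixmax (mu : 'rV[R]_m) w : 0 <m mu -> maximizer (scalarized f0 mu) S w ->
    D w /\ w = joint fx fz w.
  move=> mu0 maxw; have Dw := (box_candidates mu mu0).2 w maxw.
  by split=> //; exact: maximizer_fixpoint mu0 Dw maxw.
have one0 : 0 <m (const_mx 1 : 'rV[R]_m) by move=> i j; rewrite !mxE.
have [[ws maxws] _] := box_candidates _ one0.
have [Dws fws] := fixmax _ _ one0 maxws.
have Sws : S ws := maxws.1.
(* The maximizers for the various weights are all the same fixed point. *)
have ws_max (mu : 'rV[R]_m) w : 0 <m mu -> S w ->
    scalarized f0 mu w <= scalarized f0 mu ws.
  move=> mu0 Sw; have [[v maxv] _] := box_candidates mu mu0.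
  have [Dv fv] := fixmax _ _ mu0 maxv.
  by rewrite (fixE ws v) //; exact: maxv.2.
have ws_best w : S w -> f0 w <=m f0 ws.
  by move=> Sw; apply: mxle_of_scalarized => mu mu0; exact: ws_max.
exists ws; split; split.
- split=> // -[w [Sw wws le]]; apply: wws.
  have [Dw fw] : D w /\ w = joint fx fz w.
    apply: (fixmax _ _ one0); split=> // v Sv.
    apply: le_trans (ws_max _ _ one0 Sv) _; apply: ler_sum => k _.
    by rewrite mxE !mul1r.
  exact: fixE.
- move=> w [Sw best]; apply: contrapT => wsw; apply: best.
  by exists ws; split => //; exact: ws_best.
- by [].
- by move=> w [Dw fw]; exact: fixE.
Qed.
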